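(* Every tetrahedron in $\mathbb{R}^3$ of unit volume whose surface area is less than or equal to that of the Sommerville No. 1 tetrahedron of unit volume has all its dihedral angles in the range $[\theta_0,\pi-\theta_0]$, where $$\theta_0=\sin^{-1}\left(\frac{27}{32\sqrt{2}}\right)\approx 36.63^\circ.$$
   Context: A tetrahedron means a nondegenerate tetrahedron in $\mathbb{R}^3$. The Sommerville No. 1 is the tetrahedron, determined up to similarity, in which two opposite edges have length $2$ and the other four edges have length $\sqrt{3}$ (up to scaling). *)

(* Defs.v *)
From mathcomp Require Import all_boot all_order all_algebra.
From mathcomp Require Import all_classical all_reals all_analysis.
From mathcomp Require Import ring lra.

Set Implicit Arguments.
Unset Strict Implicit.
Unset Printing Implicit Defensive.

Import Order.TTheory GRing.Theory Num.Theory.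

Local Open Scope ring_scope.

(* The norm [`|_|] of MathComp-Analysis on ['rV[R]_3] is the sup norm, so the
   Euclidean structure of R^3 is set up explicitly. *)
Section Euclidean.
Variable R : realType.
Implicit Types u v A B C D : 'rV[R]_3.

Definition dot u v : R := (u *m v^T) 0 0.

Definition eucl_norm u : R := Num.sqrt (dot u u).

Definition eucl_dist A B : R := eucl_norm (B - A).

Definition angle u v : R := acos (dot u v / (eucl_norm u * eucl_norm v)).

(* component of v orthogonal to u *)
Definition perp u v : 'rV[R]_3 := v - (dot u v / dot u u) *: u.

(* half base AB times height, the height being the distance from C to the
   line AB *)
Definition triangle_area A B C : R :=
  eucl_dist A B * eucl_norm (perp (B - A) (C - A)) / 2.

(* Interior angle along the edge AB between the half-planes bounded by the
   line AB that contain C and D: the angle between the two vectors orthogonal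
   to AB that point into these half-planes. *)
Definition dihedral_angle A B C D : R :=
  angle (perp (B - A) (C - A)) (perp (B - A) (D - A)).

End Euclidean.

Section Tetrahedra.
Variable R : realType.

(* vertices of a possibly degenerate tetrahedron *)
Definition tetra := 'I_4 -> 'rV[R]_3.

Implicit Type T : tetra.

Definition edge_mx T : 'M[R]_3 := \matrix_(i < 3) (T (lift ord0 i) - T ord0).

Definition nondegenerate_tetra T : Prop := row_free (edge_mx T).

Definition volume T : R := `|\det (edge_mx T)| / 6.

(* face opposite to the vertex i *)
Definition face_area T (i : 'I_4) : R :=
  triangle_area (T (lift i 0)) (T (lift i 1)) (T (lift i 2)).

Definition surface_area T : R := \sum_(i < 4) face_area T i.

(* c is the scaling factor; ij and kl are the two distinguished opposite
   edges *)
Definition sommerville1 T : Prop :=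
  exists c : R, 0 < c /\
  exists i j k l : 'I_4,
    [/\ uniq [:: i; j; k; l],
        eucl_dist (T i) (T j) = c * 2 /\ eucl_dist (T k) (T l) = c * 2,
        eucl_dist (T i) (T k) = c * Num.sqrt 3 /\
        eucl_dist (T i) (T l) = c * Num.sqrt 3 &
        eucl_dist (T j) (T k) = c * Num.sqrt 3 /\
        eucl_dist (T j) (T l) = c * Num.sqrt 3].

Definition theta0 : R := asin (27 / (32 * Num.sqrt 2)).

End Tetrahedra.

Definition pt3 {R : realType} (x y z : R) : 'rV[R]_3 :=
  \row_i [:: x; y; z]`_i.

Lemma dotE {R : realType} (u v : 'rV[R]_3) :
  dot u v = u 0 ord0 * v 0 ord0
    + u 0 (lift ord0 ord0) * v 0 (lift ord0 ord0)
    + u 0 (lift ord0 (lift ord0 ord0)) * v 0 (lift ord0 (lift ord0 ord0)).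
Proof. by rewrite /dot mxE !big_ord_recl big_ord0 !mxE addr0 addrA. Qed.

(* Sanity check: a Sommerville No. 1 tetrahedron of unit volume exists. *)
Lemma sommerville1_exists (R : realType) :
  exists S : tetra R, [/\ nondegenerate_tetra S, sommerville1 S & volume S = 1].
Proof.
pose c : R := powR (3 / 2) 3^-1.
have c0 : 0 < c by apply: powR_gt0; lra.
have c3 : c ^+ 3 = 3 / 2.
  rewrite -powR_mulrn ?ltW// /c -powRrM mulVf ?powRr1 //; lra.
pose S : tetra R := fun i => nth 0 [:: pt3 c 0 (c/2); pt3 (- c) 0 (c/2);
   pt3 0 c (- (c/2)); pt3 0 (- c) (- (c/2))] i.
exists S.
have dS : \det (edge_mx S) = 6.
  rewrite (expand_det_row _ ord0) !big_ord_recl big_ord0 /cofactor.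
  rewrite !(expand_det_row _ ord0) !big_ord_recl !big_ord0 /cofactor !det_mx11 !mxE /S /=.
  rewrite /pt3 /= ?mxE /=; rewrite /bump /= !exprD !expr0 !expr1.
  have -> : 6 = 4 * c ^+ 3 by rewrite c3; field.
  by field.
have vS : volume S = 1 by rewrite /volume dS ger0_norm ?divff //; lra.
split => //.
  rewrite /nondegenerate_tetra row_free_unit unitmxE dS unitfE; lra.
exists c; split => //;
exists ord0, (lift ord0 ord0), (lift ord0 (lift ord0 ord0)),
  (lift ord0 (lift ord0 (lift ord0 ord0))).
have E2 : c * 2 = Num.sqrt (4 * c ^+2).
  by rewrite (_ : 4 * c ^+ 2 = (c * 2) ^+ 2) ?sqrtr_sqr ?ger0_norm //; [lra|ring].
have E3 : c * Num.sqrt 3 = Num.sqrt (3 * c ^+2).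
  by rewrite sqrtrM // sqrtr_sqr gtr0_norm // mulrC.
split => //; rewrite ?E2 ?E3 /eucl_dist/eucl_norm !dotE !mxE /=; split; congr Num.sqrt; by field.
Qed.

(* Main.v *)
(* Let theta be the dihedral angle at an edge of length l whose two faces have
   heights a and b over it, so that 6 V = l a b sin theta.  Those two faces have
   total area l (a + b) / 2.  Projected along the edge, each of the other two
   faces becomes the triangle of area a b sin theta / 2 = 3 V / l, so together
   they have area at least 6 V / l.  By AM-GM,
     (2 x + y)^3 >= 27 x^2 y  with  x = l (a + b) / 4  and  y = 6 V / l,
   the total area A satisfies A^3 sin theta >= 243 V^2.  The Sommerville No. 1
   tetrahedron of unit volume has A^3 = 288 sqrt 2, whence
   sin theta >= 243 / (288 sqrt 2) = 27 / (32 sqrt 2). *)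
Require Import Defs.
From mathcomp Require Import all_boot all_order all_algebra.
From mathcomp Require Import all_classical all_reals all_analysis.
From mathcomp Require Import ring lra.

Import Order.TTheory GRing.Theory Num.Theory.

Local Open Scope ring_scope.

(** * Inner products *)

Section Vectors.
Set Implicit Arguments.
Unset Strict Implicit.
Variable R : realType.
Implicit Types u v w A B C D : 'rV[R]_3.

Lemma dotC u v : dot u v = dot v u.
Proof. by rewrite !dotE; ring. Qed.

Lemma dotBl u v w : dot (u - v) w = dot u w - dot v w.
Proof. by rewrite !dotE !mxE; ring. Qed.

Lemma dotBr u v w : dot w (u - v) = dot w u - dot w v.
Proof. by rewrite !(dotC w) dotBl. Qed.

Lemma dotZl (a : R) u v : dot (a *: u) v = a * dot u v.
Proof. by rewrite !dotE !mxE; ring. Qed.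

Lemma dotZr (a : R) u v : dot u (a *: v) = a * dot u v.
Proof. by rewrite !(dotC u) dotZl. Qed.

Lemma dot_ge0 u : 0 <= dot u u.
Proof. by rewrite dotE -!expr2 !addr_ge0 ?sqr_ge0. Qed.

Lemma dot_eq0 u v : dot u u = 0 -> dot u v = 0.
Proof.
rewrite dotE -!expr2 => /eqP.
rewrite !paddr_eq0 ?addr_ge0 ?sqr_ge0// !sqrf_eq0.
move=> /andP[/andP[/eqP u0 /eqP u1] /eqP u2].
by rewrite dotE u0 u1 u2 !mul0r !addr0.
Qed.

Lemma eucl_norm_ge0 u : 0 <= eucl_norm u.
Proof. exact: sqrtr_ge0. Qed.

Lemma sqr_eucl_norm u : eucl_norm u ^+ 2 = dot u u.
Proof. by rewrite sqr_sqrtr ?dot_ge0. Qed.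

Lemma dot_dist A B C : dot (B - A) (C - A) =
  (eucl_dist A B ^+ 2 + eucl_dist A C ^+ 2 - eucl_dist B C ^+ 2) / 2.
Proof. by rewrite !sqr_eucl_norm !dotE !mxE; field. Qed.

Lemma dot_perp u v w : dot u u != 0 ->
  dot (perp u v) (perp u w) = dot v w - dot u v * dot u w / dot u u.
Proof.
move=> u0; rewrite /perp !(dotBl, dotBr, dotZl, dotZr) (dotC v u).
by field.
Qed.

(** * Gram determinants, triple products and triangle areas *)

Definition gram u v : R := dot u u * dot v v - dot u v ^+ 2.

(** The determinant with rows [u], [v], [w], in coordinates so that [ring] can prove its
    identities. *)
Definition triple u v w : R :=
  let i0 := ord0 in let i1 := lift ord0 ord0 in
  let i2 := lift ord0 (lift ord0 ord0) in
  u 0 i0 * (v 0 i1 * w 0 i2 - v 0 i2 * w 0 i1)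
  - u 0 i1 * (v 0 i0 * w 0 i2 - v 0 i2 * w 0 i0)
  + u 0 i2 * (v 0 i0 * w 0 i1 - v 0 i1 * w 0 i0).

Lemma sqr_triple u v w : triple u v w ^+ 2 =
  dot u u * gram v w
  - dot u v * (dot u v * dot w w - dot v w * dot u w)
  + dot u w * (dot u v * dot v w - dot v v * dot u w).
Proof. by rewrite /gram /triple !dotE; ring. Qed.

(** Subtracting multiples of [u] from [v] and [w] preserves the Gram determinant of the three
    vectors and makes it block diagonal. *)
Lemma sqr_triple_perp u v w : dot u u != 0 ->
  dot u u * gram (perp u v) (perp u w) = triple u v w ^+ 2.
Proof.
move=> u0; rewrite sqr_triple /gram !dot_perp //.
by field.
Qed.

(** The difference of the two sides is the squared length of the double cross product
    [u x (v x w)]. *)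
Lemma sqr_triple_le u v w : triple u v w ^+ 2 <= dot u u * gram v w.
Proof.
have := dot_ge0 (dot u w *: v - dot u v *: w).
rewrite !(dotBl, dotBr, dotZl, dotZr) (dotC w v) sqr_triple.
move=> h; rewrite -subr_ge0; move: h; congr (0 <= _).
by rewrite /gram; ring.
Qed.

Lemma triangle_areaE A B C :
  triangle_area A B C = Num.sqrt (gram (B - A) (C - A)) / 2.
Proof.
rewrite /triangle_area /eucl_dist /eucl_norm -sqrtrM ?dot_ge0//.
congr (Num.sqrt _ / 2); rewrite /gram.
(* If A = B, both sides vanish, whatever the quotient in [perp] is. *)
have [u0|u0] := eqVneq (dot (B - A) (B - A)) 0.
  by rewrite u0 (dot_eq0 (C - A) u0); ring.
by rewrite dot_perp//; field.
Qed.

Lemma triangle_areaCl A B C : triangle_area A B C = triangle_area B A C.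
Proof.
rewrite !triangle_areaE; congr (Num.sqrt _ / 2).
by rewrite /gram !dotE !mxE; ring.
Qed.

Lemma triangle_areaCr A B C : triangle_area A B C = triangle_area A C B.
Proof.
rewrite !triangle_areaE; congr (Num.sqrt _ / 2).
by rewrite /gram (dotC (B - A)) (mulrC (dot (B - A) _)).
Qed.

(* The left side is twice [eucl_norm u] times the area of the projection of ABC
   along u. *)
Lemma triple_le_area u A B C :
  `|triple u (B - A) (C - A)| <= eucl_norm u * (2 * triangle_area A B C).
Proof.
rewrite triangle_areaE [2 * _]mulrC divfK ?pnatr_eq0//.
rewrite -sqrtrM ?dot_ge0// -sqrtr_sqr.
by rewrite ler_wsqrtr ?sqr_triple_le.
Qed.

(** * Dihedral angles *)

Lemma dihedral_angle_sin A B C D : triple (B - A) (C - A) (D - A) != 0 ->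
  0 <= dihedral_angle A B C D <= pi /\
  `|triple (B - A) (C - A) (D - A)| =
    eucl_norm (B - A) * eucl_norm (perp (B - A) (C - A))
      * eucl_norm (perp (B - A) (D - A)) * sin (dihedral_angle A B C D).
Proof.
set u := B - A; set v := C - A; set w := D - A => t0.
have tt0 : 0 < triple u v w ^+ 2 by rewrite exprn_even_gt0.
have u0 : dot u u != 0.
  apply: contraTneq tt0 => u0; rewrite -leNgt.
  by rewrite (le_trans (sqr_triple_le _ _ _))// u0 mul0r.
have E := sqr_triple_perp v w u0.
rewrite /dihedral_angle -/u -/v -/w /angle.
set p := perp u v in E *; set q := perp u w in E *.
have lg0 : 0 < eucl_norm u by rewrite sqrtr_gt0 lt0r u0 dot_ge0.
(* A positive Gram determinant makes [p] and [q] independent, so neither vanishes and the cosine [x]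
   below is a genuine quotient. *)
have : 0 < gram p q by rewrite -(pmulr_rgt0 _ (_ : 0 < dot u u)) ?E//
  lt0r u0 dot_ge0.
rewrite /gram subr_gt0 => pq.
have pq0 : 0 < dot p p * dot q q by apply: le_lt_trans pq; apply: sqr_ge0.
have pg0 : 0 < eucl_norm p.
  rewrite sqrtr_gt0 lt0r dot_ge0 andbT.
  by apply: contraTneq pq0 => ->; rewrite mul0r ltxx.
have qg0 : 0 < eucl_norm q.
  rewrite sqrtr_gt0 lt0r dot_ge0 andbT.
  by apply: contraTneq pq0 => ->; rewrite mulr0 ltxx.
move: E; rewrite /gram -!sqr_eucl_norm.
move: lg0 pg0 qg0; set l := eucl_norm u; set a := eucl_norm p.
set b := eucl_norm q => lg0 pg0 qg0 E.
set x := dot p q / (a * b).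
(* As [x] is the cosine of the dihedral angle, this is its squared sine. *)
have sx : 1 - x ^+ 2 = (`|triple u v w| / (l * a * b)) ^+ 2.
  rewrite [RHS]expr_div_n real_normK ?num_real// -E /x.
  by field; rewrite !lt0r_neq0.
have x1 : -1 <= x <= 1.
  have : 0 <= 1 - x ^+ 2 by rewrite sx sqr_ge0.
  by move=> h; apply/andP; split; nra.
rewrite acos_ge0// acos_lepi// sin_acos//; split => //.
rewrite sx sqrtr_sqr [X in _ * X]ger0_norm;
  last by rewrite divr_ge0// !mulr_ge0// ltW.
by field; rewrite !lt0r_neq0.
Qed.

(** * Area inequality at one edge *)

Lemma amgm3 (x y : R) : 0 <= x -> 0 <= y -> 27 * (x ^+ 2 * y) <= (2 * x + y) ^+ 3.
Proof.
move=> x0 y0; rewrite -subr_ge0.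
have -> : (2 * x + y) ^+ 3 - 27 * (x ^+ 2 * y) = (x - y) ^+ 2 * (8 * x + y) by ring.
by rewrite mulr_ge0 ?sqr_ge0// addr_ge0// mulr_ge0.
Qed.

(** The triple product is 6 V up to sign, so the left side is 243 V^2. *)
Lemma isoperimetric_dihedral A B C D : triple (B - A) (C - A) (D - A) != 0 ->
  27 / 4 * triple (B - A) (C - A) (D - A) ^+ 2 <=
  (triangle_area A B C + triangle_area A B D
     + triangle_area A C D + triangle_area B C D) ^+ 3
  * sin (dihedral_angle A B C D).
Proof.
move=> t0; have [thpi tE] := dihedral_angle_sin t0.
have s0 := sin_ge0_pi thpi.
have h3 := triple_le_area (B - A) A C D.
(* Projection along AB identifies A with B, so the base point may be moved to B. *)
have h4 : `|triple (B - A) (C - A) (D - A)| <=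
    eucl_norm (B - A) * (2 * triangle_area B C D).
  rewrite (_ : triple _ _ _ = triple (B - A) (C - B) (D - B)) ?triple_le_area//.
  by rewrite /triple !mxE; ring.
rewrite -(real_normK (num_real (triple _ _ _))).
rewrite {1}/triangle_area {1}/triangle_area.
rewrite /eucl_dist.
move: tE h3 h4 s0; rewrite -normr_gt0 in t0; move: t0.
set t := `|_|; set l := eucl_norm (B - A).
set a := eucl_norm (perp _ _); set b := eucl_norm (perp _ _).
set s := sin _; set F3 := triangle_area _ _ _; set F4 := triangle_area _ _ _.
move=> t0 tE h3 h4 s0.
have [l0 a0 b0] : [/\ 0 <= l, 0 <= a & 0 <= b] by rewrite !eucl_norm_ge0.
have lp : 0 < l.
  by rewrite lt0r l0 andbT; apply: contraTneq t0 => l1; rewrite tE l1 !mul0r ltxx.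
have tl0 : 0 <= t / l by rewrite divr_ge0// ltW.
have F34 : t / l <= F3 + F4 by rewrite ler_pdivrMr//; nra.
have x0 : 0 <= l * (a + b) / 4 by rewrite divr_ge0// mulr_ge0// addr_ge0.
(* AM-GM, where 2 x is the area of the two faces at the edge and y = [t / l] bounds the other two
   from below. *)
have S3 : 27 * ((l * (a + b) / 4) ^+ 2 * (t / l)) <=
    (l * a / 2 + l * b / 2 + F3 + F4) ^+ 3.
  apply: le_trans (amgm3 x0 tl0) _.
  have l_ab : 0 <= l * a /\ 0 <= l * b by split; exact: mulr_ge0.
  by apply: lerXn2r; rewrite ?nnegrE; lra.
apply: le_trans (ler_wpM2r s0 S3).
have -> : 27 * ((l * (a + b) / 4) ^+ 2 * (t / l)) = 27 / 16 * t * l * (a + b) ^+ 2.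
  by field; rewrite lt0r_neq0.
have ab : 4 * (a * b) <= (a + b) ^+ 2.
  by rewrite -subr_ge0 (_ : _ - _ = (a - b) ^+ 2) ?sqr_ge0//; ring.
(* Only one factor [t] is expanded by [tE]; the other already occurs in the AM-GM bound. *)
have -> : 27 / 4 * t ^+ 2 = 27 / 16 * t * l * (4 * (a * b)) * s.
  by rewrite expr2 {2}tE; field.
rewrite ler_wpM2r// ler_wpM2l//.
by rewrite !mulr_ge0// ltW.
Qed.

(** Up to pi / 2 the sine is increasing; beyond it, [asin x <= pi / 2] suffices. *)
Lemma asin_le_sin (x y : R) : -1 <= x <= 1 -> 0 <= y <= pi -> x <= sin y ->
  asin x <= y.
Proof.
move=> x1 /andP[y0 ypi] xy.
have p0 := pi_ge0 R.
have [yp|/ltW yp] := leP y (pi / 2); last exact: le_trans (asin_lepi2 x1) yp.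
rewrite leNgt -ltr_sin ?in_itv/= ?asin_geNpi2 ?asin_lepi2 ?yp ?andbT//; last by lra.
by rewrite asinK ?in_itv//= -leNgt.
Qed.

End Vectors.

(** Adjacent transpositions generate all permutations, so any labelling reduces to the standard
    one. *)
Lemma sym4_invariant (X Y : Type) (f : X -> X -> X -> X -> Y)
  (f12 : forall a b c d, f a b c d = f b a c d)
  (f23 : forall a b c d, f a b c d = f a c b d)
  (f34 : forall a b c d, f a b c d = f a b d c)
  (T : 'I_4 -> X) (i j k l : 'I_4) : uniq [:: i; j; k; l] ->
  f (T i) (T j) (T k) (T l) =
  f (T ord0) (T (lift ord0 ord0)) (T (lift ord0 (lift ord0 ord0)))
    (T (lift ord0 (lift ord0 (lift ord0 ord0)))).
Proof.
set o1 : 'I_4 := lift ord0 ord0; set o2 : 'I_4 := lift ord0 (lift ord0 ord0).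
set o3 : 'I_4 := lift ord0 (lift ord0 (lift ord0 ord0)).
have ord4 (m : 'I_4) : [\/ m = ord0, m = o1, m = o2 | m = o3].
  by case: m => [[|[|[|[|//]]]] m4];
    [apply: Or41|apply: Or42|apply: Or43|apply: Or44]; exact: val_inj.
(* On numerals [uniq] computes, leaving only the 24 permutations. *)
rewrite -(map_inj_uniq val_inj) /= !inE.
case: (ord4 i) (ord4 j) => -> [] -> //=; case: (ord4 k) => -> //=;
  case: (ord4 l) => -> //= _.
all: move: (T ord0) (T o1) (T o2) (T o3) => a b c d.
(* Bubble sort: each rule swaps one adjacent inverted pair, so this terminates. *)
all: by rewrite ?(f12 b a, f12 c a, f12 d a, f12 c b, f12 d b, f12 d c,
  fun x => f23 x b a, fun x => f23 x c a, fun x => f23 x d a,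
  fun x => f23 x c b, fun x => f23 x d b, fun x => f23 x d c,
  fun x y => f34 x y b a, fun x y => f34 x y c a, fun x y => f34 x y d a,
  fun x y => f34 x y c b, fun x y => f34 x y d b, fun x y => f34 x y d c).
Qed.

(** * Surface area and volume under any labelling of the vertices *)

Section Tetrahedron.
Set Implicit Arguments.
Unset Strict Implicit.
Variable R : realType.
Implicit Types S T : tetra R.

Lemma surface_areaE T (i j k l : 'I_4) : uniq [:: i; j; k; l] ->
  surface_area T =
    triangle_area (T i) (T j) (T k) + triangle_area (T i) (T j) (T l)
    + triangle_area (T i) (T k) (T l) + triangle_area (T j) (T k) (T l).
Proof.
rewrite /surface_area /face_area.
move: (@triangle_areaCl R) (@triangle_areaCr R) => + + ijkl.
move: (@triangle_area R) => g gCl gCr.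
pose f A B C D := g A B C + g A B D + g A C D + g B C D.
have := @sym4_invariant _ _ f _ _ _ T _ _ _ _ ijkl.
rewrite /f => -> => [|A B C D|A B C D|A B C D].
- have gE (m a b c : 'I_4) : val (lift m 0) = a -> val (lift m 1) = b ->
      val (lift m 2) = c ->
      g (T (lift m 0)) (T (lift m 1)) (T (lift m 2)) = g (T a) (T b) (T c).
    by move=> /val_inj -> /val_inj -> /val_inj ->.
  pose o1 : 'I_4 := lift ord0 ord0; pose o2 : 'I_4 := lift ord0 (lift ord0 ord0).
  pose o3 : 'I_4 := lift ord0 (lift ord0 (lift ord0 ord0)).
  (* Reversed order: the face opposite the last vertex is the first summand of [f]. *)
  have sum4 (F : 'I_4 -> R) : \sum_(m < 4) F m = F o3 + F o2 + F o1 + F ord0.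
    by rewrite !big_ord_recl big_ord0 /o1 /o2 /o3; ring.
  rewrite sum4 -/o1 -/o2 -/o3 (gE ord0 o1 o2 o3)// (gE o1 ord0 o2 o3)//.
  by rewrite (gE o2 ord0 o1 o3)// (gE o3 ord0 o1 o2).
- by rewrite (gCl A B C) (gCl A B D); ring.
- by rewrite (gCr A B C) (gCl B C D); ring.
- by rewrite (gCr A C D) (gCr B C D); ring.
Qed.

Lemma det_mx33 (M : 'M[R]_3) :
  \det M = triple (row ord0 M) (row (lift ord0 ord0) M)
             (row (lift ord0 (lift ord0 ord0)) M).
Proof.
(* Indexing by [nat] makes different terms for the same ordinal agree, as [ring] requires. *)
have [m mE] : exists m : nat -> nat -> R, forall i j, M i j = m i j.
  by exists (fun a b => M (inord a) (inord b)) => i j; rewrite !inord_val.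
rewrite (expand_det_row _ ord0) !big_ord_recl big_ord0 /cofactor.
rewrite !(expand_det_row _ ord0) !big_ord_recl !big_ord0 /cofactor.
rewrite !det_mx11 /triple !mxE !mE /= /bump /=.
by ring.
Qed.

(** Swapping two vertices only changes the sign of the triple product. *)
Lemma volumeE T (i j k l : 'I_4) : uniq [:: i; j; k; l] ->
  `|triple (T j - T i) (T k - T i) (T l - T i)| = 6 * volume T.
Proof.
pose f A B C D : R := `|triple (B - A) (C - A) (D - A)|.
move=> ijkl; have := @sym4_invariant _ _ f _ _ _ T _ _ _ _ ijkl.
rewrite /f => -> => [|A B C D|A B C D|A B C D].
- rewrite /volume mulrC divfK ?pnatr_eq0//; congr `|_|.
  by rewrite det_mx33 !rowK.
all: by rewrite -normrN; congr `|_|; rewrite /triple !mxE; ring.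
Qed.

(** * The Sommerville No. 1 tetrahedron *)

Lemma sommerville1_surface_area S : sommerville1 S -> volume S = 1 ->
  surface_area S ^+ 3 = 288 * Num.sqrt 2.
Proof.
move=> [c [c0 [i [j [k [l [ijkl [ij kl] [ik il] [jk jl]]]]]]]] V.
have s3 : Num.sqrt 3 ^+ 2 = 3 :> R by rewrite sqr_sqrtr.
(* Unit volume fixes the scale: the squared triple product is 16 c^6 = 36. *)
have c6 : c ^+ 6 = 9 / 4.
  have := volumeE S ijkl; rewrite V mulr1 => /(congr1 (fun x => x ^+ 2)).
  rewrite real_normK ?num_real// sqr_triple /gram -!sqr_eucl_norm !dot_dist.
  rewrite -!/(eucl_dist _ _) ij ik il jk jl kl !exprMn s3 => E.
  suff : 16 * c ^+ 6 = 36 by lra.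
  by transitivity (6 ^+ 2 : R); [rewrite -E; field|ring].
(* The premise involves only squared side lengths, so it covers all four congruent faces. *)
have face A B C : eucl_dist A B ^+ 2 * eucl_dist A C ^+ 2 -
    ((eucl_dist A B ^+ 2 + eucl_dist A C ^+ 2 - eucl_dist B C ^+ 2) / 2) ^+ 2
      = (2 * c ^+ 2) ^+ 2 * 2 ->
    triangle_area A B C = c ^+ 2 * Num.sqrt 2.
  rewrite triangle_areaE /gram -!sqr_eucl_norm dot_dist -!/(eucl_dist _ _) => ->.
  rewrite sqrtrM ?sqr_ge0// sqrtr_sqr ger0_norm; last first.
    exact: mulr_ge0 (ler0n _ _) (sqr_ge0 _).
  by field.
rewrite (surface_areaE S ijkl) !face ?ij ?ik ?il ?jk ?jl ?kl ?exprMn ?s3;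
  [|by field..].
transitivity (64 * c ^+ 6 * Num.sqrt 2 ^+ 2 * Num.sqrt 2); first by ring.
by rewrite c6 sqr_sqrtr//; field.
Qed.

End Tetrahedron.

(** * The bounds on the dihedral angles *)

Theorem corollary8p3 (R : realType) (S T : tetra R)
  (S_nondegenerate : nondegenerate_tetra S)
  (S_sommerville : sommerville1 S)
  (S_volume : volume S = 1)
  (T_nondegenerate : nondegenerate_tetra T)
  (T_volume : volume T = 1)
  (area_le : surface_area T <= surface_area S)
  (i j k l : 'I_4) (ijkl : uniq [:: i; j; k; l]) :
  theta0 R <= dihedral_angle (T i) (T j) (T k) (T l) <= pi - theta0 R.
Proof.
have tE := volumeE T ijkl; rewrite T_volume mulr1 in tE.
have t0 : triple (T j - T i) (T k - T i) (T l - T i) != 0.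
  by rewrite -normr_gt0 tE.
have [thpi _] := dihedral_angle_sin t0.
have := isoperimetric_dihedral t0.
rewrite -(real_normK (num_real (triple _ _ _))) tE -surface_areaE//.
move: thpi; set th := dihedral_angle _ _ _ _ => thpi isop.
have s0 := sin_ge0_pi thpi.
have T0 : 0 <= surface_area T.
  by apply: sumr_ge0 => m _; rewrite /face_area triangle_areaE divr_ge0 ?sqrtr_ge0.
have {}isop : 243 <= 288 * Num.sqrt 2 * sin th.
  rewrite -(sommerville1_surface_area S_sommerville)//.
  apply: le_trans (_ : surface_area T ^+ 3 * sin th <= _); first lra.
  by rewrite ler_wpM2r// lerXn2r// nnegrE (le_trans T0).
(* This keeps the denominator of [x] positive and puts [x] in the domain of [asin]. *)
have r2 : 1 <= Num.sqrt 2 :> R by rewrite -{1}sqrtr1 ler_wsqrtr// ler1n.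
set x : R := 27 / (32 * Num.sqrt 2).
have xs : x <= sin th by rewrite ler_pdivrMr; lra.
have x0 : 0 <= x by apply: divr_ge0; lra.
have x1 : -1 <= x <= 1.
  by rewrite (le_trans _ x0) ?lerN10//= ler_pdivrMr; lra.
rewrite /theta0 -/x asin_le_sin//=.
(* The upper bound is the lower bound for pi - [th], which has the same sine. *)
rewrite lerBrDr addrC -lerBrDr asin_le_sin//.
  by move: thpi => /andP[]; lra.
by rewrite sinB sinpi cospi mul0r mulN1r sub0r opprK.
Qed.
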